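(* (1) Every interpretable space $X$ is the image under a continuous open surjection of a $G_\delta$ subspace of a compact space $Z$ such that the weight of $Z$ is no larger than the weight of $X$. (2) Every second countable interpretable space is Polish.
   Context: A space is Čech complete if it is homeomorphic to a $G_\delta$ subspace of a compact Hausdorff space; a space is interpretable if it is regular Hausdorff and the image of a Čech complete space under a continuous open surjection. The weight of a space is the least cardinality of a basis of its topology. *)

(* Defs.v *)
From HB Require Import structures.
From mathcomp Require Import all_boot all_order all_algebra.
From mathcomp Require Import all_classical all_reals all_analysis.
From mathcomp Require Import Rstruct.
From Stdlib Require Rdefinitions.
Notation Rs := Rdefinitions.R.
Set Implicit Arguments. Unset Strict Implicit. Unset Printing Implicit Defensive.
Import Order.TTheory GRing.Theory Num.Theory.
Local Open Scope classical_set_scope.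
Local Open Scope ring_scope.

(* Subsets [Y : set Z] of a topological space are viewed as spaces through
   the library type [set_type Y] (written [Y : Type]), which carries the
   genuine subspace (initial) topology. *)

Definition open_map (S T : topologicalType) (f : S -> T) : Prop :=
  forall U : set S, open U -> open (f @` U).

Definition Gdelta (Z : topologicalType) (A : set Z) : Prop :=
  exists F : nat -> set Z, (forall n, open (F n)) /\ A = \bigcap_n F n.

Definition compact_hausdorff (Z : topologicalType) : Prop :=
  compact [set: Z] /\ hausdorff_space Z.

Definition homeomorphism (S T : topologicalType) (h : S -> T) : Prop :=
  continuous h /\ exists g : T -> S,
    cancel h g /\ cancel g h /\ continuous g.

Definition cech_complete (W : topologicalType) : Prop :=
  exists (Z : topologicalType) (Y : set Z),
    compact_hausdorff Z /\ Gdelta Y /\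
    exists h : W -> (Y : Type), homeomorphism h.

Definition interpretable (X : topologicalType) : Prop :=
  regular_space X /\ hausdorff_space X /\
  exists (W : topologicalType) (f : W -> X),
    cech_complete W /\ continuous f /\ open_map f /\ (forall x : X, exists w, f w = x).

(* weight Z <= weight X, where the weight is the least cardinality of a
   basis: for every basis of X there is a basis of Z of no larger
   cardinality (equivalent, as the minimum is attained) *)
Definition weight_le (Z X : topologicalType) : Prop :=
  forall BX : set (set X), basis BX ->
    exists BZ : set (set Z), basis BZ /\ (BZ #<= BX)%card.

Definition separable_space (X : topologicalType) : Prop :=
  exists D : set X, countable D /\ dense D.

Definition completely_metrizable (X : topologicalType) : Prop :=
  exists d : X -> X -> Rs,
    (forall x y, 0 <= d x y) /\
    (forall x y, d x y = 0 <-> x = y) /\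
    (forall x y, d x y = d y x) /\
    (forall x y z, d x z <= d x y + d y z) /\
    (forall U : set X, open U <->
       (forall x, U x -> exists2 e : Rs, 0 < e & [set y | d x y < e] `<=` U)) /\
    (forall u : nat -> X,
       (forall e : Rs, 0 < e -> exists N : nat, forall m n : nat,
           (N <= m)%N -> (N <= n)%N -> d (u m) (u n) < e) ->
       exists l : X, u @ \oo --> l).

Definition polish (X : topologicalType) : Prop :=
  separable_space X /\ completely_metrizable X.

(* Main.v *)
(* The two halves of the theorem share one object: a complete sieve on X, that
   is, a tree of open sets U(s), indexed by finite words over a basis of X,
   such that every point of U(s) lies in some U(i :: s), cl U(i :: s) is
   contained in U(s), and every filter containing the sets of a branch
   clusters. It is the image of a tree of open sets of the compact space, the
   successors being chosen one for each basic open set of X.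
   For (1), the pairs (branch, point of its intersection) form a space whose
   projection to X is open, because a point of U(s) lies on a branch through s,
   and whose projection to the branches is perfect. So it is normal and has a
   complete sequence of open covers, hence it is a G-delta in its closure in a
   cube. All index sets are made of finite words over a basis of X, whose
   cardinality does not exceed that of the basis when it is infinite.
   For (2), the sieve on X is weighted by continuous functions in such a way
   that, along a Cauchy sequence, each node has finitely many children of
   positive limit weight; Koenig's lemma then gives a branch containing the
   sequence. *)

Require Import Defs.
From HB Require Import structures.
From mathcomp Require Import all_boot all_order all_algebra.
From mathcomp Require Import all_classical all_reals all_analysis.
From mathcomp Require Import finmap Rstruct lra.
Set Implicit Arguments.
Unset Strict Implicit.
Unset Printing Implicit Defensive.
Import Order.TTheory GRing.Theory Num.Theory.
Import numFieldNormedType.Exports.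
Local Open Scope classical_set_scope.
Local Open Scope card_scope.
Local Open Scope ring_scope.

(** * Cardinality of the set of finite words *)

Lemma card_le_inj_image (I T U : Type) (A : set T) (B : set U)
    (f : T -> I) (g : U -> I) :
  set_inj A f -> f @` A `<=` g @` B -> A #<= B.
Proof.
move=> fI fAgB.
have h1 : A #<= f @` A by rewrite (card_le_eqr (inj_card_eq fI)).
exact: card_le_trans h1 (card_le_trans (subset_card_le fAgB) (card_image_le _ _)).
Qed.

(* Hoenig's argument: a maximal set of choice functions that pairwise differ
   everywhere exhausts one of the [A k]. *)
Lemma card_le_minimum (K T : Type) (A : K -> set T) (k1 : K) :
  exists k0, forall k, A k0 #<= A k.
Proof.
pose P (F : set (K -> T)) := (forall g, F g -> forall k, A k (g k)) /\
  (forall g h, F g -> F h -> forall k, g k = h k -> g = h).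
have [|F [[FA Finj] Fmax]] := @Zorn_bigcup _ P.
  move=> C CP totC; split=> [g [F CF Fg]|g h [F CF Fg] [G CG Gh] k].
    by have [+ _] := CP _ CF; apply.
  have [FG|GF] := totC _ _ CF CG.
    by have [_] := CP _ CG; apply => //; exact: FG.
  by have [_] := CP _ CF; apply => //; exact: GF.
(* Otherwise each [A k] has an element that no member of [F] takes at [k]; these form a choice
   function that enlarges [F]. *)
have [k0 Ak0] : exists k0, A k0 `<=` (@^~ k0) @` F.
  apply: contrapT => /forallNP nA.
  have /choice[g gP] : forall k, exists a, A k a /\ forall h, F h -> h k <> a.
    move=> k; have /existsNP[a /not_implyP[Aa Fa]] := nA k.
    by exists a; split=> // h Fh hk; apply: Fa; exists h.
  have nFg : ~ F g by move=> Fg; have [_ /(_ _ Fg)] := gP k1.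
  apply: (Fmax (F `|` [set g])).
    by split=> [h|sub]; [left|apply: nFg; apply: sub; right].
  split=> [h [/FA//|-> k]|h h' [Fh|->] [Fh'|->] k //].
  - by have [] := gP k.
  - exact: Finj.
  - by have [_ /(_ _ Fh)] := gP k.
  - by have [_ /(_ _ Fh') + /esym] := gP k.
exists k0 => k; apply: card_le_trans (subset_card_le Ak0) _.
apply: card_le_trans (card_image_le _ _) _.
apply: (@card_le_inj_image _ _ _ _ _ (@^~ k) id) => [g h /set_mem Fg /set_mem Fh|].
  exact: Finj.
by move=> _ [g Fg <-]; rewrite image_id; exact: FA.
Qed.

(** Comparability is the minimum of a family with two members; the sum type puts both sets in one
    type. *)
Lemma card_le_total (T U : Type) (A : set T) (B : set U) : A #<= B \/ B #<= A.
Proof.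
pose S (b : bool) : set (T + U) := if b then inl @` A else inr @` B.
have [b Sb] := card_le_minimum S true.
have eA : @inl T U @` A #= A by apply: inj_card_eq => ? ? _ _ [].
have eB : @inr T U @` B #= B by apply: inj_card_eq => ? ? _ _ [].
case: b Sb => [/(_ false)|/(_ true)] /=.
  by rewrite (card_le_eql eA) (card_le_eqr eB); left.
by rewrite (card_le_eql eB) (card_le_eqr eA); right.
Qed.

Lemma card_le_injP (T U : Type) (A : set T) (B : set U) (u0 : U) : A #<= B ->
  exists f : T -> U, (forall x, A x -> B (f x)) /\
    forall x y, A x -> A y -> f x = f y -> x = y.
Proof.
move=> /card_leP[g].
exists (fun x => if pselect (A x) is left Ax
  then set_val (g (SigSub (mem_set Ax))) else u0).
split=> [x Ax|x y Ax Ay]; case: pselect => // {}Ax.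
  exact: set_valP.
case: pselect => // {}Ay /val_inj gxy.
by have /(congr1 set_val) := inj (in_setT _) (in_setT _) gxy.
Qed.

(** * Injecting the finite words over an infinite set into that set *)

Section seq_injection.
Variable I : choiceType.
Implicit Types (G : set (seq I * I)) (l : seq I).

Let base G : set I := [set a | exists x, G ([:: a], x)].

(** [G] is the graph of an injection into [base G] from the nonempty words over [base G]. Reading
    the alphabet off [G] makes inclusion of graphs the order for Zorn's lemma. *)
Let partial_inj G :=
  [/\ forall l x, G (l, x) -> [/\ l <> [::], all (mem (base G)) l & base G x],
      forall l, l <> [::] -> all (mem (base G)) l -> exists x, G (l, x),
      forall l x y, G (l, x) -> G (l, y) -> x = y &
      forall l l' x, G (l, x) -> G (l', x) -> l = l'].

Let baseS G G' : G `<=` G' -> base G `<=` base G'.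
Proof. by move=> GG' a [x Gx]; exists x; exact: GG'. Qed.

Let all_baseS G G' l : G `<=` G' -> all (mem (base G)) l -> all (mem (base G')) l.
Proof.
move=> GG' /allP h; apply/allP => x /h /set_mem Gx.
by apply/mem_set/baseS/Gx.
Qed.

Let partial_inj_bigcup (C : set (set (seq I * I))) :
  C `<=` partial_inj -> total_on C subset -> partial_inj (\bigcup_(G in C) G).
Proof.
move=> CP totC; set U := \bigcup_(G in C) G.
have sub G : C G -> G `<=` U by move=> CG p Gp; exists G.
split=> [l x [G CG Glx]|||].
- have [/(_ _ _ Glx)[ln lG xG] _ _ _] := CP _ CG.
  by split=> //; [exact: all_baseS (sub _ CG) _|exact: baseS (sub _ CG) _ _].
(* A word has finitely many letters, so one member of the chain has them all in its base. *)
- move=> l ln lU; suff [G CG lG] : exists2 G, C G & all (mem (base G)) l.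
    have [_ /(_ _ ln lG)[x Glx] _ _] := CP _ CG.
    by exists x; exists G.
  elim: l ln lU => [//|a l IH] _ /= /andP[/set_mem[x [G CG Gax]]].
  case: l IH => [_ _|b l /(_ _)/(_ _)/= IH bl].
    by exists G => //; rewrite /= andbT; apply/mem_set; exists x.
  have [//|H CH Hl] := IH _ bl.
  have Ga : base G a by exists x.
  have [GH|HG] := totC _ _ CG CH.
    by exists H => //=; rewrite Hl andbT; apply/mem_set; exact: baseS Ga.
  exists G => //=; have := @all_baseS _ _ (b :: l) HG Hl; rewrite /= => ->; rewrite andbT.
  exact/mem_set.
- move=> l x y [G CG Gx] [H CH Hy].
  by have [GH|HG] := totC _ _ CG CH;
    [have [_ _ + _] := CP _ CH|have [_ _ + _] := CP _ CG]; apply; eauto.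
- move=> l l' x [G CG Gx] [H CH Hy].
  by have [GH|HG] := totC _ _ CG CH;
    [have [_ _ _] := CP _ CH|have [_ _ _] := CP _ CG]; apply; eauto.
Qed.

(* Zorn's lemma on injections from the nonempty words over a subset [S] of [I]
   into [S]; when [S] is not larger than its complement, the domain can be
   enlarged to the words over [S] and a disjoint copy of [S]. *)
Lemma seq_injection : infinite_set [set: I] ->
  exists phi : seq I -> I, injective phi.
Proof.
move=> Iinf; have [x0 _] := infinite_setN0 Iinf.
have [nu [_ nuI]] := card_le_injP x0 ((infiniteP _).1 Iinf).
have {}nuI : injective nu by move=> i j /nuI; exact.
have [G [PG Gmax]] := Zorn_bigcup partial_inj_bigcup.
set S := base G; have [GS Gex Gfun Ginj] := PG.
(* The empty graph is not maximal: a countable subset of [I] carries such an injection, by the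
   enumeration of words over [nat]. *)
have [S0|S0] := eqVneq S set0.
  exfalso; pose G' := [set p | exists m, [/\ m <> [::],
    p.1 = map nu m & p.2 = nu (choice.pickle (m : seq nat))]].
  have bG' : base G' = range nu.
    apply/seteqP; split=> [a [x [m [mn /= am _]]]|_ [n _ <-]].
      by case: m mn am => [//|n [|//]] _ [->]; exists n.
    by exists (nu (choice.pickle [:: n])), [:: n].
  apply: (Gmax G').
    split=> [[l x] /GS[ln]|sub].
      by rewrite -/S S0; case: l ln => //= a l _ /andP[/set_mem].
    have : G ([:: nu 0%N], nu (choice.pickle [:: 0%N])) by apply: sub; exists [:: 0%N].
    by move=> /GS[_ _]; rewrite -/S S0.
  split=> [l x [m [mn /= -> ->]]|l ln|l x y [m [_ /= -> ->]] [m' [_ /= + ->]]|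
           l l' x [m [_ /= -> ->]] [m' [_ /= -> +]]].
  - rewrite bG'; split=> //; first by case: m mn.
    by apply/allP => x' /mapP[n _ ->]; apply/mem_set; exists n.
  - rewrite bG' => lnu; have [m lm] : exists m, l = map nu m.
      elim: l {ln} lnu => [|a l IH] /=; first by exists [::].
      by move=> /andP[/set_mem[n _ <-] /IH[m ->]]; exists (n :: m).
    by exists (nu (choice.pickle m)), m; split=> // m0; apply: ln; rewrite lm m0.
  - by move=> /(inj_map nuI) ->.
  - by move=> /nuI /(pcan_inj choice.pickleK) ->.
have [s0 Ss0] : S !=set0 by exact/set0P.
have /choice[phi phiP] : forall l, exists x, l <> [::] -> all (mem S) l -> G (l, x).
  move=> l; have [[ln lS]|h] := pselect (l <> [::] /\ all (mem S) l).
    by have [x Gx] := Gex _ ln lS; exists x.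
  by exists x0 => ? ?; exfalso; exact: h.
have phiS l : l <> [::] -> all (mem S) l -> S (phi l).
  by move=> ln lS; have [] := GS _ _ (phiP _ ln lS).
have phiI l l' : l <> [::] -> all (mem S) l -> l' <> [::] -> all (mem S) l' ->
    phi l = phi l' -> l = l'.
  move=> ln lS l'n l'S e; apply: (Ginj _ _ (phi l)); first exact: phiP.
  by rewrite e; exact: phiP.
(* Codes the words over [S] and a further set [D] that [e] injects into [S]: a letter of [S] becomes
   the code of a word of length one, any other letter that of a word of length two, so the two kinds
   do not collide. *)
have code (D : set I) (e : I -> I) : (forall x, D x -> S (e x)) ->
    (forall x y, D x -> D y -> e x = e y -> x = y) ->
    exists psi : seq I -> I,
      (forall l, l <> [::] -> all (mem (S `|` D)) l -> S (psi l)) /\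
      forall l l', l <> [::] -> all (mem (S `|` D)) l -> l' <> [::] ->
        all (mem (S `|` D)) l' -> psi l = psi l' -> l = l'.
  move=> eS eI; pose c x := if x \in S then phi [:: x] else phi [:: e x; e x].
  have cw x : (S `|` D) x ->
      exists w, [/\ w <> [::], all (mem S) w, c x = phi w &
        w = if x \in S then [:: x] else [:: e x; e x]].
    rewrite /c => SDx; case: ifPn => [Sx|/negP Sx].
      by exists [:: x]; split=> //=; rewrite andbT.
    exists [:: e x; e x]; split=> //=.
    have : D x by case: SDx => // Sx'; case: Sx; exact: mem_set.
    by move=> /eS/mem_set eSx; rewrite andbT; apply/andP.
  have cS x : (S `|` D) x -> S (c x).
    by move=> /cw[w [wn wS -> _]]; exact: phiS.
  have cI x y : (S `|` D) x -> (S `|` D) y -> c x = c y -> x = y.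
    move=> SDx SDy; have [w [wn wS -> ew]] := cw _ SDx.
    have [v [vn vS -> ev]] := cw _ SDy.
    move=> /(phiI _ _ wn wS vn vS); rewrite ew ev.
    case: ifPn => [_|/negP nx]; case: ifPn => [_|/negP ny] //; first by case.
    case=> exy _; apply: eI exy.
      by case: SDx => // /mem_set/nx.
    by case: SDy => // /mem_set/ny.
  have mS l : all (mem (S `|` D)) l -> all (mem S) (map c l).
    rewrite all_map; apply: sub_all => x /set_mem SDx.
    by apply/mem_set; exact: cS.
  exists (phi \o map c); split=> [l ln lS|l l' ln lS l'n l'S /= /phiI].
    by apply: phiS; [case: l ln {lS}|exact: mS].
  move=> /(_ _)/(_ _)/(_ _)/(_ _) h; have {h} : map c l = map c l'.
    by apply: h; [case: l ln {lS}|exact: mS|case: l' l'n {l'S}|exact: mS].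
  elim: l l' lS l'S {ln l'n} => [|a l IH] [|b l'] //=.
  move=> /andP[/set_mem Sa lS] /andP[/set_mem Sb l'S] [/cI -> //].
  by move=> /IH ->.
have [le|le] := card_le_total (~` S) S.
  have [e [eS eI]] := card_le_injP x0 le.
  have [psi [_ psiI]] := code _ _ eS eI.
  (* The letter [x0] in front makes every word nonempty, as the injectivity of [psi] requires. *)
  exists (fun l => psi (x0 :: l)) => l l' e1.
  have allT l1 : all (mem (S `|` ~` S)) l1.
    by apply/allP => x _; rewrite setUv; exact/mem_set.
  have nn l1 : x0 :: l1 <> [::] by [].
  by have [] := psiI _ _ (nn l) (allT _) (nn l') (allT _) e1.
exfalso; have [d [dS dI]] := card_le_injP x0 le.
have /choice[r rP] : forall x, exists y, (d @` S) x -> S y /\ d y = x.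
  move=> x; have [[y Sy <-]|h] := pselect ((d @` S) x); first by exists y.
  by exists x0 => /h.
have [||psi [psiS psiI]] := code (d @` S) r.
- by move=> x /rP[].
- by move=> x y /rP[_ {2}<-] /rP[_ {2}<-] ->.
pose S' := S `|` d @` S.
pose G' := G `|` [set p | [/\ p.1 <> [::], all (mem S') p.1,
  ~~ all (mem S) p.1 & p.2 = d (psi p.1)]].
have dnS x : S x -> (d x \in S) = false.
  by move=> Sx; apply/negP => /set_mem; exact: dS.
have bG' : base G' = S'.
  apply/seteqP; split=> [a [x [Gax|[/= _ + _ _]]]|a [[x Gax]|Da]].
  - by left; exists x.
  - by rewrite andbT => /set_mem.
  - by exists x; left.
  - exists (d (psi [:: a])); right; split=> //=.
      by rewrite andbT; apply/mem_set; right.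
    by rewrite andbT; case: Da => y Sy <-; rewrite dnS.
have SS' l : all (mem S) l -> all (mem S') l.
  by apply: sub_all => x /set_mem Sx; apply/mem_set; left.
apply: (Gmax G').
  split=> [p Gp|sub]; first by left.
  have : G ([:: d s0], d (psi [:: d s0])).
    apply: sub; right; split => //=; rewrite ?andbT ?dnS //.
    by apply/mem_set; right; exists s0.
  by move=> /GS[_ /=]; rewrite andbT -/S dnS.
split=> [l x [Glx|[/= ln lS _ ->]]|l ln|l x y|l l' x]; rewrite ?bG'.
- by have [ln lS Sx] := GS _ _ Glx; split=> //; [exact: SS'|left].
- by split=> //; right; exists (psi l) => //; exact: psiS.
- move=> lS'; have [lS|lS] := boolP (all (mem S) l).
    by have [x Gx] := Gex _ ln lS; exists x; left.
  by exists (d (psi l)); right.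
- move=> [Gx|[/= _ _ nS ->]] [Gy|[/= _ _ nS' ->]] //.
  + exact: Gfun Gx Gy.
  + by have [_ lS] := GS _ _ Gx; rewrite lS in nS'.
  + by have [_ lS] := GS _ _ Gy; rewrite lS in nS.
- have dpsi l1 : l1 <> [::] -> all (mem S') l1 -> ~ S (d (psi l1)).
    by move=> ? ?; apply: dS; exact: psiS.
  move=> [Gx|[/= ln lS nS ->]] [Gy|[/= ln' lS' nS' e]] //.
  + exact: Ginj Gx Gy.
  + by have [_ _] := GS _ _ Gx; rewrite e => /dpsi; case.
  + by have [_ _ /dpsi] := GS _ _ Gy; case.
  + by apply: psiI => //; apply: dI e; exact: psiS.
Qed.

End seq_injection.

(** * Complete sieves *)

Lemma regular_space_open (T : topologicalType) (x : T) (A : set T) :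
  regular_space T -> open A -> A x ->
  exists V, [/\ open V, V x & closure V `<=` A].
Proof.
move=> rT oA Ax; have [V + VA] := rT x A (open_nbhs_nbhs (conj oA Ax)).
rewrite nbhsE => -[W [oW Wx] WV]; exists W; split=> //.
exact: subset_trans (closureS WV) VA.
Qed.

Lemma basisP (T : topologicalType) (I : Type) (B : I -> set T) :
  basis (range B) <-> (forall i, open (B i)) /\
    forall x A, open A -> A x -> exists i, B i x /\ B i `<=` A.
Proof.
split=> -[oB bB]; split.
- by move=> i; apply: oB; exists i.
- move=> x A oA Ax; have [_ [[i _ <-] Bix] BA] := bB x A (open_nbhs_nbhs (conj oA Ax)).
  by exists i.
- by move=> _ [i _ <-].
- move=> x A; rewrite /= nbhsE => -[V [oV Vx] VA]; have [i [Bx BV]] := bB _ _ oV Vx.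
  by exists (B i); [split=> //; exists i|exact: subset_trans VA].
Qed.

(** Čech completeness as a map [i] into [K]: its image is the intersection of the [F n], and
    preimages of open sets give the neighbourhoods in [W]. *)
Lemma cech_complete_embedding (W : topologicalType) : cech_complete W ->
  exists (K : topologicalType) (F : nat -> set K) (i : W -> K),
    [/\ compact_hausdorff K, forall n, open (F n),
        forall k, (forall n, F n k) <-> exists w, i w = k &
        forall w (A : set W), nbhs w A <->
          exists O : set K, [/\ open O, O (i w) & forall v, O (i v) -> A v]].
Proof.
move=> [K [Y [cK [[F [oF YF]] [h [ch [g [hK [gK cg]]]]]]]]].
have YFE k : Y k = (\bigcap_n F n) k by rewrite -YF.
exists K, F, (set_val \o h); split=> // [k|w A].
  split=> [Fk|[w <-] n /=]; last first.
    by have : Y (set_val (h w)) := set_valP _; rewrite YFE; apply.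
  have Yk : Y k by rewrite YFE.
  by exists (g (SigSub (mem_set Yk))); rewrite /= gK.
split=> [wA | [ O [oO Ow OA]]].
  have : nbhs (h w) (g @^-1` A) by apply: cg; rewrite hK.
  rewrite nbhsE => -[_ [[ O oO <-] Ow] OA].
  by exists O; split=> // v Ov; rewrite -(hK v); exact: OA.
have : nbhs (h w) (set_val @^-1` O).
  by apply: open_nbhs_nbhs; split=> //; exists O.
by move=> /ch /=; rewrite nbhs_simpl /=; apply: filterS => v; exact: OA.
Qed.

(** The newest letter comes first, so that the children of a node [s] are the words [i :: s]. *)
Fixpoint prefix_of (I : Type) (b : nat -> I) n :=
  if n is m.+1 then b m :: prefix_of b m else [::].

Lemma size_prefix_of (I : Type) (b : nat -> I) n : size (prefix_of b n) = n.
Proof. by elim: n => //= n ->. Qed.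

Definition complete_sieve (X : topologicalType) (I : Type) (U : seq I -> set X) :=
  [/\ U [::] = setT, forall s, open (U s),
      forall s x, U s x -> exists i, U (i :: s) x,
      forall i s, closure (U (i :: s)) `<=` U s &
      forall b (F : set_system X), ProperFilter F ->
        (forall n, F (U (prefix_of b n))) -> cluster F !=set0].

(** The sieve consists of the images of open sets [O s] of [K] whose closures shrink into the
    successive [F n]. A filter along a branch lifts to [K], clusters there by compactness, and the
    cluster point comes from [W] since it lies in every [F n]. *)
Lemma interpretable_sieve (X : topologicalType) (I : Type) (B : I -> set X) :
  interpretable X -> basis (range B) ->
  exists U : seq I -> set X, complete_sieve U.
Proof.
move=> [rX [hX [W [f [+ [cf [opf fsurj]]]]]]] /basisP[oB bB].
move=> /cech_complete_embedding[K [F [i [[cK hK] oF Fi iW]]]].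
have rK : regular_space K.
  by move=> k; apply: (compact_regular hK cK); exact: filterT.
pose img (O : set K) := f @` (i @^-1` O).
have oimg O : open O -> open (img O).
  move=> oO; apply: opf; rewrite openE => w Ow; apply/iW.
  by exists O.
have imgS O O' : O `<=` O' -> img O `<=` img O'.
  by move=> sub _ [w Ow <-]; exists w => //; exact: sub.
pose ch n O O' := [/\ open O', closure O' `<=` O `&` F n &
  closure (img O') `<=` img O].
(* Shrink once in [K] and once in [X]; the successor is the first open set intersected with one that
   pulls the second back to [K]. *)
have chP n O x : open O -> img O x ->
    exists O' j, [/\ ch n O O', B j x & B j `<=` img O'].
  move=> oO [w Ow <-]; have FO : (O `&` F n) (i w).
    by split=> //; apply: (Fi (i w)).2; exists w.
  have [ O1 [oO1 O1w O1O]] := regular_space_open rK (openI oO (oF n)) FO.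
  have [|V [oV Vx VO]] := @regular_space_open _ (f w) _ rX (oimg _ oO).
    by exists w.
  have /iW[ O2 [oO2 O2w O2V]] : nbhs w (f @^-1` V).
    by apply: cf; exact: open_nbhs_nbhs.
  have [||j [Bx BO]] := bB (f w) (img (O1 `&` O2)).
  - by apply: oimg; exact: openI.
  - by exists w.
  exists (O1 `&` O2), j; split=> //; split.
  - exact: openI.
  - by apply: subset_trans O1O; apply: closureS => ? [].
  - apply: subset_trans VO; apply: closureS.
    by move=> _ [v [_ /O2V Vv] <-].
(* One successor for each basic set [B p.2]: an admissible set whose image contains [B p.2], if
   there is any. Otherwise the empty set will do, as it is admissible too. *)
have /choice[c cP] : forall p : nat * set K * I, exists O', ch p.1.1 p.1.2 O' /\
    ((exists O'', ch p.1.1 p.1.2 O'' /\ B p.2 `<=` img O'') -> B p.2 `<=` img O').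
  move=> [[n O] j] /=.
  have [[ O' [chO' BO']]|h] :=
      pselect (exists O'', ch n O O'' /\ B j `<=` img O'').
    by exists O'.
  exists set0; split; last by move=> /h.
  have img0 : img set0 = set0 by rewrite /img preimage_set0 image_set0.
  by split; [exact: open0|rewrite closure0|rewrite img0 closure0].
pose O := fix O s := if s is j :: s' then c (size s', O s', j) else setT.
have oO s : open (O s).
  by case: s => [|j s]; [exact: openT|have [[]] := cP (size s, O s, j)].
have OS j s : closure (O (j :: s)) `<=` O s `&` F (size s).
  by have [[]] := cP (size s, O s, j).
exists (img \o O); split=> [|s|s x Ux|j s|b G PG Gb] /=.
- by apply/seteqP; split=> // x _; have [w <-] := fsurj x; exists w.
- exact: oimg.
- have [ O' [j [chO' Bx BO']]] := chP (size s) _ _ (oO s) Ux.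
  exists j; have [_ h] := cP (size s, O s, j).
  by apply: h Bx; exists O'.
- by have [[]] := cP (size s, O s, j).
(* The base of the lift of the filter [G] to [K], along the branch [b]. *)
pose E (p : set X * nat) := i @` (f @^-1` p.1 `&` i @^-1` O (prefix_of b p.2)).
have Omono m n : (m <= n)%N -> O (prefix_of b n) `<=` O (prefix_of b m).
  elim: n => [|n IH]; first by rewrite leqn0 => /eqP ->.
  rewrite leq_eqVlt => /orP[/eqP -> //|mn]; apply: subset_trans (IH mn).
  by move=> k /subset_closure/OS[].
pose H := filter_from [set p | G p.1] E.
have PH : ProperFilter H.
  apply: filter_from_proper.
    apply: filter_from_filter; first by exists (setT, 0%N); exact: filterT.
    move=> [A m] [A' n] /= GA GA'; exists (A `&` A', maxn m n).
      exact: filterI.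
    move=> _ [w [[Aw A'w] Ow] <-]; split; exists w => //; split=> //=.
      exact: Omono (leq_maxl _ _) _ Ow.
    exact: Omono (leq_maxr _ _) _ Ow.
  move=> [A n] /= GA; have [x [Ax [w Ow wx]]] := filter_ex (filterI GA (Gb n)).
  by exists (i w), w => //; split=> //=; rewrite wx.
have [k [_ kH]] := cK H PH filterT.
have [w wk] : exists w, i w = k.
  (* Depth [n.+1] is used because the closure of that set lies in [F n]. *)
  apply/Fi => n; rewrite -(size_prefix_of b n).
  suff /OS[] : closure (O (prefix_of b n.+1)) k by [].
  move=> A Ak; apply: kH Ak; exists (setT, n.+1); first exact: filterT.
  by move=> _ [v [_ Ov] <-].
exists (f w) => A N GA /cf /iW[ O2 [oO2 O2w O2N]].
have [//||_ [[v [/= Av _] <-] /O2N Nv]] := kH (E (A, 0%N)) O2.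
- by exists (A, 0%N).
- by apply: open_nbhs_nbhs; rewrite -wk.
by exists (f v).
Qed.

(** * Embedding in a cube *)

Lemma nbhs_set_typeE (T : topologicalType) (K : set T) (z : K) (A : set K) :
  nbhs z A <-> exists O : set T,
    [/\ open O, O (set_val z) & forall w : K, O (set_val w) -> A w].
Proof.
rewrite nbhsE; split=> [[_ [[ O oO <-] Oz] OA]|[ O [oO Oz OA]]]; first by exists O.
by exists (set_val @^-1` O) => //; split=> //; exists O.
Qed.

Lemma set_val_continuous (T : topologicalType) (K : set T) :
  continuous (set_val : K -> T).
Proof. exact: initial_continuous. Qed.

Lemma hausdorff_set_type (T : topologicalType) (K : set T) :
  hausdorff_space T -> hausdorff_space K.
Proof.
move=> hT p q pq; apply: val_inj; apply: hT => A B /set_val_continuous pA.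
by move=> /set_val_continuous qB; have [z [Az Bz]] := pq _ _ pA qB; exists (set_val z).
Qed.

Lemma compact_set_type (T : topologicalType) (K : set T) :
  compact K -> compact [set: K].
Proof.
move=> cK F PF _.
have FK : (set_val @ F) K.
  by apply: (@filterS _ F _ setT) => [z _|]; [exact: set_valP|exact: filterT].
have [k [Kk kF]] := cK (set_val @ F) _ FK.
exists (SigSub (mem_set Kk)); split=> // A B FA /nbhs_set_typeE[ O [oO Ok OB]].
have [||k' [[z Az zk'] Ok']] := kF (set_val @` A) O.
- by apply: (@filterS _ F _ A) => // z Az; exists z.
- exact: open_nbhs_nbhs.
- by exists z; split=> //; apply: OB; rewrite zk'.
Qed.

Section embedding.
Context {R : realType}.

(** The cozero sets of the [e j] form a basis of [T]. *)
Definition separating (T : topologicalType) (J : Type) (e : J -> T -> R) :=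
  [/\ forall j, continuous (e j), forall j x, 0 <= e j x <= 1 &
      forall x A, open A -> A x ->
        exists j, 0 < e j x /\ forall y, ~ A y -> e j y = 0].

(* For each pair [(P, Q)] of basic open sets choose, if possible, a function
   that exceeds [1/2] on [P] and vanishes outside [Q]. *)
Lemma separating_family (T : topologicalType) (I : Type) (B : I -> set T) :
  basis (range B) -> @completely_regular_space T ->
  exists e : I * I -> T -> R, separating e.
Proof.
move=> /basisP[oB bB] crT.
pose good (p : I * I) (f : T -> R) := [/\ continuous f, forall x, 0 <= f x <= 1,
  forall x, B p.1 x -> 1 / 2 < f x & forall x, ~ B p.2 x -> f x = 0].
have /choice[e eP] : forall p, exists f : T -> R,
    [/\ continuous f, forall x, 0 <= f x <= 1 &
      (exists f', good p f') -> good p f].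
  move=> p; have [[f gf]|h] := pselect (exists f, good p f).
    by exists f; case: (gf).
  exists (cst 0); split=> [x|x|//]; first exact: cvg_cst.
  by rewrite lexx ler01.
exists e; split=> [p|p|x A oA Ax]; [by have [] := eP p|by have [] := eP p|].
have [j [Bx BA]] := bB _ _ oA Ax.
(* Complete regularity gives [f] equal to 0 at [x] and to 1 off [B j]; on a basic set where [f] is
   below one half, [1 - f] exceeds one half. *)
have /(@uniform_separatorP _ R)[f [cf f01 f0 f1]] := crT x (~` B j)
  (open_closedC (oB j)) (fun h => h Bx).
have fx : f x = 0 by apply: f0; exists x.
have [||i [Bi Bf]] := bB x (f @^-1` [set r | r < 1 / 2]).
- by apply: open_comp => [y _|]; [exact: cf|exact: open_lt].
- by rewrite /= fx divr_gt0.
have [_ _ [|_ _ e12 e0]] := eP (i, j).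
  exists (fun y => 1 - f y); split=> /= [y|y|y /Bf /=|y nBy].
  - by apply: cvgB; [exact: cvg_cst|exact: cf].
  - have : range f (f y) by exists y.
    by move=> /f01; rewrite /= in_itv /= => /andP[f0y f1y]; rewrite subr_ge0 f1y lerBlDr lerDl.
  - by lra.
  - by have -> : f y = 1 by [apply: f1; exists y]; rewrite subrr.
exists (i, j); split=> [|y nA]; first by apply: lt_trans (e12 _ Bi); rewrite divr_gt0.
by apply: e0 => /BA.
Qed.

(** [Z] is the closure of the image of [T] in the cube over [J]. A point of [Z] lies in the image as
    soon as it has, for each [n], a neighbourhood whose trace lies in a member of [C n]: the trace
    of its neighbourhood filter then clusters in [T]. *)
Lemma embedding_compact (T : topologicalType) (J : choiceType)
    (e : J -> T -> R) (C : nat -> set (set T)) :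
  hausdorff_space T -> separating e ->
  (forall n x, exists V, [/\ C n V, open V & V x]) ->
  (forall F : set_system T, ProperFilter F ->
    (forall n, exists2 V, C n V & F V) -> cluster F !=set0) ->
  exists (Z : topologicalType) (Y : set Z) (G : seq (J * bool * rat) -> set Z)
    (k : Y -> T),
    [/\ compact_hausdorff Z, Gdelta Y & basis (range G)] /\
    [/\ continuous k, open_map k & forall x, exists y, k y = x].
Proof.
move=> hT [ce e01 esep] Ccov Ccpl.
pose P : topologicalType := {ptws J -> R}.
have hP : hausdorff_space P by apply: hausdorff_product => j; exact: Rhausdorff.
pose E : T -> P := fun x j => e j x.
have cE : continuous E.
  move=> x; apply/cvg_sup => j A.
  rewrite nbhsE => -[_ [[ O oO <-] Ox] OA].
  suff : nbhs x (e j @^-1` O) by apply: filterS => y Oy; exact: OA.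
  by apply: ce; exact: open_nbhs_nbhs.
pose K : set P := closure (range E).
have cube : compact [set f : P | forall j, `[0 : R, 1]%classic (f j)].
  by apply: (@tychonoff J (fun=> R) (fun=> `[0, 1]%classic)) => j; exact: segment_compact.
have cK : compact K.
  apply: (subclosed_compact _ cube); first exact: closed_closure.
  have /closure_id -> : closed [set f : P | forall j, `[0 : R, 1]%classic (f j)].
    exact: compact_closed cube.
  by apply: closureS => _ [x _ <-] j /=; rewrite in_itv /=; exact: e01.
pose Z : topologicalType := K.
pose E' (x : T) : Z := SigSub (mem_set (subset_closure (imageP E (I : setT x)))).
have hZ : hausdorff_space Z by exact: hausdorff_set_type.
have cZ : compact [set: Z] by exact: compact_set_type.
have cE' : continuous E'.
  move=> x A /nbhs_set_typeE[ O [oO Ox OA]].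
  suff : nbhs x (E @^-1` O) by apply: filterS => y Oy; exact: OA.
  by apply: cE; exact: open_nbhs_nbhs.
have cpr j : continuous (fun z : Z => set_val z j).
  move=> z; apply: (@continuous_comp Z P R set_val (proj j)).
    exact: set_val_continuous.
  exact: proj_continuous.
(* Half-spaces with rational bounds; their finite intersections are the basis of [Z]. *)
pose S (p : J * bool * rat) := [set z : Z |
  if p.1.2 then set_val z p.1.1 < ratr p.2 :> R else ratr p.2 < set_val z p.1.1 :> R].
have oS p : open (S p).
  case: p => [[j []] q].
    by apply: (@open_comp Z R (fun z => set_val z j) [set r | r < ratr q]) => [z _|];
      [exact: cpr|exact: open_lt].
  by apply: (@open_comp Z R (fun z => set_val z j) [set r | ratr q < r]) => [z _|];
      [exact: cpr|exact: open_gt].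
have Ssep z z' : z <> z' -> exists p p', [/\ S p z, S p' z' & S p `&` S p' = set0].
  move=> zz'; have [j zj] : exists j, set_val z j <> set_val z' j.
    apply: contrapT => /forallNP h; apply/zz'/val_inj/funext => j.
    by apply: contrapT => /h.
  have [lt|lt|//] := ltgtP (set_val z j) (set_val z' j).
    have [q] := rat_in_itvoo lt; rewrite in_itv /= => /andP[zq qz'].
    exists (j, true, q), (j, false, q); split=> //.
    by apply/seteqP; split=> // y [] /= /lt_trans h /h; rewrite ltxx.
  have [q] := rat_in_itvoo lt; rewrite in_itv /= => /andP[zq qz'].
  exists (j, false, q), (j, true, q); split=> //.
  by apply/seteqP; split=> // y [] /= + /lt_trans h => /h; rewrite ltxx.
pose G s := foldr (fun p A => S p `&` A) setT s.
have GI s t : G (s ++ t) = G s `&` G t.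
  by elim: s => [|p s IH] /=; rewrite ?setTI // IH setIA.
have oG s : open (G s) by elim: s => [|p s IH] /=; [exact: openT|exact: openI].
(* By compactness, if no [G s] around [z] lies in [A], their parts outside [A] cluster at some [z'].
   If [z'] is [z], the neighbourhood [A] excludes this; otherwise two disjoint half-spaces do. *)
have bG : basis (range G).
  apply/basisP; split=> // z A oA Az; apply: contrapT => /forallNP nG.
  pose F := filter_from [set s | G s z] (fun s => G s `\` A).
  have PF : ProperFilter F.
    apply: filter_from_proper => [|s /= Gz].
      apply: filter_from_filter; first by exists [::].
      move=> s t /= sz tz; exists (s ++ t); rewrite /= GI //.
      by move=> y [[sy ty] nAy].
    apply/set0P/eqP => /seteqP[GA _]; apply: (nG s); split=> // y Gy.
    by apply: contrapT => nAy; exact: (GA y).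
  have [z' [_ z'F]] := cZ F PF filterT.
  have [zz'|zz'] := pselect (z = z').
    have [//||y [[_ nAy] Ay]] := z'F (G [::] `\` A) A.
    - by exists [::].
    - by rewrite -zz'; exact: open_nbhs_nbhs.
    - exact: nAy.
  have [p [p' [Sp Sp' SS]]] := Ssep _ _ zz'.
  have [//||y [[[Spy _] _] Spy']] := z'F (G [:: p] `\` A) (S p').
  - by exists [:: p].
  - exact: open_nbhs_nbhs.
  - by have : (S p `&` S p') y by []; rewrite SS.
pose Y : set Z := range E'.
have sepZ x A : open A -> A x -> exists N : set Z,
    [/\ open N, N (E' x) & forall y, N (E' y) -> A y].
  move=> oA Ax; have [j [ex e0]] := esep _ _ oA Ax.
  exists ((fun z : Z => set_val z j) @^-1` [set r | 0 < r]); split=> //.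
    by apply: open_comp => [z _|];
      [exact: cpr|exact: open_gt].
  by move=> y ey; apply: contrapT => /e0 ey0; have : 0 < e j y := ey; rewrite ey0 ltxx.
have E'inj x y : E' x = E' y -> x = y.
  move=> exy; apply: contrapT => /eqP xy.
  have [A [oA /set_mem Ax /set_mem Ay]] := hausdorff_accessible hT xy.
  by have [N [_ Nx NA]] := sepZ _ _ oA Ax; apply/Ay/NA; rewrite -exy.
have /choice[k kP] : forall y : Y, exists x, E' x = set_val y.
  by move=> y; have [x _ <-] : Y (set_val y) := set_valP y; exists x.
exists Z, Y, G, k; split; split=> //.
- exists (fun n => \bigcup_(O in [set O : set Z | open O /\
      exists2 V, C n V & E' @^-1` O `<=` V]) O); split=> [n|].
    by apply: bigcup_open => O [].
  apply/seteqP; split=> [_ [x _ <-] n _|z zF].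
    have [V [CV oV Vx]] := Ccov n x; have [N [oN Nx NV]] := sepZ _ _ oV Vx.
    by exists N => //; split=> //; exists V.
  (* The trace on [T] of the neighbourhood filter of [z]; it is proper because the image of [T] is
     dense in [Z]. *)
  pose F := filter_from (nbhs z) (preimage E').
  have PF : ProperFilter F.
    apply: filter_from_proper.
      apply: filter_from_filter; first by exists setT; exact: filterT.
      by move=> A B zA zB; exists (A `&` B) => //; exact: filterI.
    move=> A /nbhs_set_typeE[ O [oO Oz OA]].
    have [_ [[x _ <-] Ox]] : range E `&` O !=set0.
      have : K (set_val z) := set_valP z; apply.
      exact: open_nbhs_nbhs.
    by exists x; exact: OA.
  have [|x xF] := Ccpl F PF.
    move=> n; have [ O [oO [V CV OV]] Oz] := zF n I.
    by exists V => //; exists O => //; exact: open_nbhs_nbhs.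
  exists x => //; apply/esym/hZ => A B zA xB.
  have [||y [Ay By]] := xF (E' @^-1` A) (E' @^-1` B).
  - by exists A.
  - exact: cE'.
  - by exists (E' y).
- move=> y A; rewrite nbhsE => -[A' [oA' A'y] A'A].
  have [N [oN Ny NA]] := sepZ _ _ oA' A'y.
  apply/nbhs_set_typeE; exists N; split=> //; first by rewrite -kP.
  by move=> w Nw; apply/A'A/NA; rewrite kP.
- move=> _ [ O oO <-]; rewrite openE => _ [y Oy <-].
  suff : nbhs (k y) (E' @^-1` O).
    apply: filterS => x Ox; have Yx : Y (E' x) by exists x.
    exists (SigSub (mem_set Yx)); first exact: Ox.
    by apply: E'inj; rewrite kP.
  by apply: cE'; apply: open_nbhs_nbhs; split=> //; rewrite kP.
- move=> x; have Yx : Y (E' x) by exists x.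
  by exists (SigSub (mem_set Yx)); apply: E'inj; rewrite kP.
Qed.

End embedding.

(** * The space of branches *)

Lemma eq_prefix_of_le (I : Type) (b b' : nat -> I) m n : (m <= n)%N ->
  prefix_of b n = prefix_of b' n -> prefix_of b m = prefix_of b' m.
Proof.
elim: n => [|n IH]; first by rewrite leqn0 => /eqP ->.
rewrite leq_eqVlt => /orP[/eqP -> //|mn] /= [_]; exact: IH.
Qed.

Definition branch_space (X : topologicalType) (I : Type) (U : seq I -> set X) :=
  {p : (nat -> I) * X | forall n, U (prefix_of p.1 n) p.2}.

Section branch_topology.
Variables (X : topologicalType) (I : Type) (U : seq I -> set X).
Local Notation Y := (branch_space U).

Definition branch (p : Y) : nat -> I := (proj1_sig p).1.
Definition branch_pt (p : Y) : X := (proj1_sig p).2.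

(** The subspace topology of the product of [X] with the sequences over the discrete set [I]: a
    basic neighbourhood fixes [n] letters and an open set of [X]. *)
Definition branch_open (A : set Y) := forall p, A p -> exists n V,
  [/\ open V, V (branch_pt p) & forall q,
    prefix_of (branch q) n = prefix_of (branch p) n -> V (branch_pt q) -> A q].

HB.instance Definition _ := gen_eqMixin Y.
HB.instance Definition _ := gen_choiceMixin Y.

Let branch_openT : branch_open setT.
Proof. by move=> p _; exists 0%N, setT; split=> //; exact: openT. Qed.

Let branch_openI (A B : set Y) : branch_open A -> branch_open B ->
  branch_open (A `&` B).
Proof.
move=> oA oB p [/oA[m [V [oV Vp VA]]] /oB[n [W [oW Wp WB]]]].
exists (maxn m n), (V `&` W); split=> // [|q qp [Vq Wq]]; first exact: openI.
split; first by apply: VA Vq; apply: eq_prefix_of_le qp; rewrite leq_maxl.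
by apply: WB Wq; apply: eq_prefix_of_le qp; rewrite leq_maxr.
Qed.

Let branch_open_bigU (K : Type) (f : K -> set Y) :
  (forall i, branch_open (f i)) -> branch_open (\bigcup_i f i).
Proof.
move=> fo p [i _ /fo[n [V [oV Vp Vf]]]]; exists n, V; split=> // q qp Vq.
by exists i => //; exact: Vf.
Qed.

HB.instance Definition _ :=
  isOpenTopological.Build Y branch_openT branch_openI branch_open_bigU.

Lemma branch_openE (A : set Y) : open A = branch_open A.
Proof. by []. Qed.

Definition cylinder (s : seq I) : set Y :=
  [set p | prefix_of (branch p) (size s) = s].

Lemma branch_in_sieve (p : Y) n : U (prefix_of (branch p) n) (branch_pt p).
Proof. exact: (proj2_sig p). Qed.

Lemma open_cylinder s : open (cylinder s).
Proof.
rewrite branch_openE => p sp; exists (size s), setT; split=> [||q qp _] //.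
  exact: openT.
by rewrite /cylinder /= qp.
Qed.

Lemma branch_pt_continuous : continuous branch_pt.
Proof.
apply/continuousP => A oA; rewrite branch_openE => p Ap.
by exists 0%N, A.
Qed.

Lemma branch_nbhs (p : Y) (A : set Y) : nbhs p A -> exists n V,
  [/\ open V, V (branch_pt p) & forall q,
    prefix_of (branch q) n = prefix_of (branch p) n -> V (branch_pt q) -> A q].
Proof.
rewrite nbhsE => -[B [+ Bp] BA]; rewrite branch_openE => /(_ p Bp).
by move=> [n [V [oV Vp VB]]]; exists n, V; split=> // q qp Vq; apply/BA/VB.
Qed.

Lemma branch_ext (p q : Y) : (forall n, prefix_of (branch p) n = prefix_of (branch q) n) ->
  branch_pt p = branch_pt q -> p = q.
Proof.
move=> pq xy; have bpq : branch p = branch q.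
  by apply/funext => n; have [] := pq n.+1.
move: p q {pq} xy bpq => [[b x] p] [[b' x'] q]; rewrite /branch /branch_pt /=.
by move=> xx' bb'; move: p q; rewrite xx' bb' => p q; congr exist; exact: Prop_irrelevance.
Qed.

Lemma branch_hausdorff : hausdorff_space X -> hausdorff_space Y.
Proof.
move=> hX p q pq; apply: branch_ext => [n|].
  have [|| r [rp rq]] := pq (cylinder (prefix_of (branch p) n))
      (cylinder (prefix_of (branch q) n)).
  - apply: open_nbhs_nbhs; split; first exact: open_cylinder.
    by rewrite /cylinder /= size_prefix_of.
  - apply: open_nbhs_nbhs; split; first exact: open_cylinder.
    by rewrite /cylinder /= size_prefix_of.
  by move: rp rq; rewrite /cylinder /= !size_prefix_of => -> ->.
apply: hX => A B /branch_pt_continuous pA /branch_pt_continuous qB.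
by have [r [Ar Br]] := pq _ _ pA qB; exists (branch_pt r).
Qed.

Lemma branch_basis (J : Type) (B : J -> set X) : basis (range B) ->
  basis (range (fun p : seq I * J => cylinder p.1 `&` branch_pt @^-1` B p.2)).
Proof.
move=> /basisP[oB bB]; apply/basisP; split=> [[s j]|p A oA Ap] /=.
  apply: openI; first exact: open_cylinder.
  by apply: open_comp => [q _|]; [exact: branch_pt_continuous|exact: oB].
have [n [V [oV Vp VA]]] := oA p Ap; have [j [Bp BV]] := bB _ _ oV Vp.
exists (prefix_of (branch p) n, j); split=> [|q [/=]].
  by split=> //=; rewrite /cylinder /= size_prefix_of.
by rewrite /cylinder /= size_prefix_of => qp /BV; exact: VA.
Qed.

Hypothesis sieve : complete_sieve U.

(** Each point of a node lies in a child of it, so dependent choice prolongs [s] to a branch; the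
    shorter prefixes contain [x] by nesting. *)
Lemma branch_through s x : U s x ->
  exists p : Y, branch_pt p = x /\ cylinder s p.
Proof.
have [U0 _ Uex Ucl _] := sieve => Ux.
have UU i t y : U (i :: t) y -> U t y by move=> /subset_closure/Ucl.
have /choice[nxt nxtP] : forall t : {t | U t x}, exists i, U (i :: sval t) x.
  by move=> [t Ut] /=; exact: Uex.
pose st n : {t | U t x} :=
  iter n (fun t => exist (fun t => U t x) (nxt t :: sval t) (nxtP t)) (exist _ s Ux).
have [i0 _] := Uex _ _ Ux.
(* The first letters spell [s], reversed because words carry the newest letter first; the chosen
   letters follow. *)
pose b n := if (n < size s)%N then nth i0 (rev s) n else nxt (st (n - size s)%N).
have bs n : (n <= size s)%N -> prefix_of b n = drop (size s - n) s.
  elim: n => [|n IH] ns /=; first by rewrite subn0 drop_size.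
  rewrite /b ns IH ?(ltnW ns) // nth_rev //.
  rewrite [RHS](drop_nth i0) ?subnSK //.
  exact: leq_subr.
have bst n : prefix_of b (n + size s) = sval (st n).
  elim: n => [|n IH] /=; first by rewrite add0n bs // subnn drop0.
  by rewrite IH /b ltnNge leq_addl /= addnK.
have Ub n : U (prefix_of b n) x.
  have h m : U (prefix_of b (m + n)) x -> U (prefix_of b n) x.
    by elim: m => //= m IH /UU.
  by apply: (h (size s)); rewrite addnC bst; exact: (proj2_sig (st n)).
exists (exist _ (b, x) Ub); split=> //.
by rewrite /cylinder /branch /=; have := bst 0%N; rewrite add0n.
Qed.

(** The neighbourhood given by [n] letters and [V] projects onto [V] intersected with the set of
    that node, since each point there lies on a branch through the node. *)
Lemma branch_pt_open : open_map branch_pt.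
Proof.
have [_ oU _ _ _] := sieve.
move=> A oA; rewrite openE => _ [p Ap <-].
have [n [V [oV Vp VA]]] := oA p Ap.
apply: (@filterS _ _ _ (V `&` U (prefix_of (branch p) n))).
  move=> x [Vx /branch_through[q [qx qp]]]; exists q => //.
  by apply: VA; rewrite ?qx //; move: qp; rewrite /cylinder /= size_prefix_of.
apply: open_nbhs_nbhs; split; first exact: openI.
by split=> //; exact: branch_in_sieve.
Qed.

Lemma branch_pt_surj x : exists p, branch_pt p = x.
Proof.
have [U0 _ _ _ _] := sieve.
by have [|p [px _]] := @branch_through [::] x; [rewrite U0|exists p].
Qed.

(** This makes the projection to the branches perfect. The image filter in [X] clusters by
    completeness of the sieve, and the nested closures put the cluster point in every node of
    [b]. *)
Lemma branch_cluster (F : set_system Y) (b : nat -> I) : ProperFilter F ->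
  (forall n, F (cylinder (prefix_of b n))) ->
  exists p, branch p = b /\ cluster F p.
Proof.
have [_ _ _ Ucl Ucpl] := sieve => PF Fb.
have [n|x xF] := Ucpl b (branch_pt @ F) _.
  apply: (@filterS _ F _ (cylinder (prefix_of b n))) => // p.
  by rewrite /cylinder /= size_prefix_of => <-; exact: branch_in_sieve.
have Ub n : U (prefix_of b n) x.
  apply: (Ucl (b n)) => A xA; apply: xF xA.
  apply: (@filterS _ F _ (cylinder (prefix_of b n.+1))) => // p.
  by rewrite /cylinder size_prefix_of => bp; have := branch_in_sieve p n.+1; rewrite bp.
exists (exist _ (b, x) Ub); split=> // A N FA /branch_nbhs[n [V [oV Vx VN]]].
have [||_ [[p [Ap bp] <-] Vp]] := xF (branch_pt @` (A `&` cylinder (prefix_of b n))) V.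
- apply: (@filterS _ F _ (A `&` cylinder (prefix_of b n))); last exact: filterI.
  by move=> p Ap; exists p.
- exact: open_nbhs_nbhs.
exists p; split=> //; apply: VN => //.
by move: bp; rewrite /cylinder /= size_prefix_of.
Qed.

(** Two cylinders in a proper filter meet, so the words of lengths [n] and [n.+1] are consecutive
    prefixes of one branch. *)
Lemma branch_complete (F : set_system Y) : ProperFilter F ->
  (forall n, exists2 V, [set cylinder s | s in [set s | size s = n]] V & F V) ->
  cluster F !=set0.
Proof.
move=> PF Fs.
have /choice[s sP] : forall n, exists s, size s = n /\ F (cylinder s).
  by move=> n; have [_ [s sn <-] Fn] := Fs n; exists s.
have /choice[b bP] : forall n, exists i, s n.+1 = i :: s n.
  move=> n; have [sn Fn] := sP n; have [sn1 Fn1] := sP n.+1.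
  have [p []] := filter_ex (filterI Fn Fn1).
  by rewrite /cylinder /= sn sn1 /= => -> <-; exists (branch p n).
have bs n : prefix_of b n = s n.
  elim: n => [|n IH] /=; last by rewrite IH bP.
  by have [/size0nil] := sP 0%N.
have [p [_ pF]] := @branch_cluster F b _ (fun n => ltac:(rewrite bs; exact: (sP n).2)).
by exists p.
Qed.

(* The projection to the (ultraparacompact) space of branches is perfect:
   disjoint closed sets are separated over a cylinder around each branch, and
   the minimal such cylinders are pairwise disjoint. *)
Lemma branch_normal : regular_space X -> normal_space Y.
Proof.
have [_ _ _ Ucl Ucpl] := sieve => rX.
apply/(@normal_openP Rs) => E F cE cF EF.
pose sep s (O : set X * set X) := [/\ open O.1, open O.2, O.1 `&` O.2 = set0,
  forall p, E p -> cylinder s p -> O.1 (branch_pt p) &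
  forall p, F p -> cylinder s p -> O.2 (branch_pt p)].
have sep_ex b : exists n O, sep (prefix_of b n) O.
  pose cyl n : set Y := [set p | prefix_of (branch p) n = prefix_of b n].
  have cylE n : cylinder (prefix_of b n) = cyl n by rewrite /cylinder size_prefix_of.
  (* Candidates for covering the part of [E] near [b]: open sets whose closure avoids the part of
     [F] over some cylinder around [b]. *)
  pose ok V := open V /\ exists m, forall p, F p -> cyl m p ->
    ~ closure V (branch_pt p).
  pose D (q : nat * set X) := E `&` cyl q.1 `\` branch_pt @^-1` q.2.
  have [[n [V [[oV [m Vm]] D0]]]|/forallNP nD] :=
      pselect (exists n V, ok V /\ D (n, V) = set0).
    exists (maxn n m), (V, ~` closure V); split=> //=.
    - by apply: closed_openC; exact: closed_closure.
    - by apply/seteqP; split=> // x [/subset_closure].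
    - move=> p Ep; rewrite cylE => bp; apply: contrapT => nV.
      suff : D (n, V) p by rewrite D0.
      by split=> //; split=> //; apply: eq_prefix_of_le bp; rewrite leq_maxl.
    - move=> p Fp; rewrite cylE => bp; apply: Vm => //.
      by apply: eq_prefix_of_le bp; rewrite leq_maxr.
  (* If no candidate covers [E] over a cylinder, what the candidates leave of [E] generates a filter
     along [b]. It clusters at a point of [E], around which regularity of [X] gives a candidate. *)
  pose H := filter_from [set q | ok q.2] D.
  have PH : ProperFilter H.
    apply: filter_from_proper => [|[n V] okV].
      apply: filter_from_filter.
        exists (0%N, set0); split; first exact: open0.
        by exists 0%N => p _ _; rewrite closure0.
      move=> [n V] [n' V'] /= [oV [m Vm]] [oV' [m' Vm']].
      exists (maxn n n', V `|` V').
        split; first exact: openU.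
        exists (maxn m m') => p Fp bp; rewrite closureU => -[]; [apply: Vm => //|apply: Vm' => //].
          by apply: eq_prefix_of_le bp; rewrite leq_maxl.
        by apply: eq_prefix_of_le bp; rewrite leq_maxr.
      move=> p [[Ep bp] /not_orP[Vp V'p]]; split; split=> //; split=> //.
        by apply: eq_prefix_of_le bp; rewrite leq_maxl.
      by apply: eq_prefix_of_le bp; rewrite leq_maxr.
    by apply/set0P/eqP => D0; apply: (nD n); exists V.
  have [n|p [pb pH]] := @branch_cluster H b PH.
    rewrite cylE; exists (n, set0); last by move=> p [[]].
    by split; [exact: open0|exists 0%N => p _ _; rewrite closure0].
  have Ep : E p.
    apply: cE => A pA; have [||q [[[Eq _] _] Aq]] := pH (D (0%N, set0)) A.
    - exists (0%N, set0) => //.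
      by split; [exact: open0|exists 0%N => q _ _; rewrite closure0].
    - exact: pA.
    - by exists q.
  have nFp : ~ F p by move=> Fp; have : (E `&` F) p by []; rewrite EF.
  have oF : branch_open (~` F) := closed_openC cF.
  have [m [V [oV Vp VF]]] := oF p nFp.
  have [W [oW Wp WV]] := regular_space_open rX oV Vp.
  have [||q [[_ nWq] Wq]] := pH (D (0%N, W)) (branch_pt @^-1` W).
  - exists (0%N, W) => //; split=> //; exists m => q Fq bq /WV Vq.
    by apply: VF Fq => //; rewrite pb.
  - by apply: branch_pt_continuous; exact: open_nbhs_nbhs.
  - by case: (nWq Wq).
have /choice[ O OP] : forall s, exists O, (exists O', sep s O') -> sep s O.
  move=> s; have [[ O sO]|h] := pselect (exists O, sep s O); first by exists O.
  by exists (set0, set0) => /h.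
pose good b n := `[< exists O, sep (prefix_of b n) O >].
have good_ex b : exists n, good b n.
  by have [n sn] := sep_ex b; exists n; apply/asboolP.
pose nm b := ex_minn (good_ex b).
have nmP b : sep (prefix_of b (nm b)) (O (prefix_of b (nm b))).
  by apply: OP; rewrite /nm; case: ex_minnP => n /asboolP.
(* The least depth of separation along [b] is shared by all branches that agree with [b] up to that
   depth. So it is constant on these cylinders, and the pairs chosen there glue to open sets. *)
have nm_le b c : prefix_of b (nm b) = prefix_of c (nm b) -> (nm c <= nm b)%N.
  move=> bc; rewrite {1}/nm; case: ex_minnP => n _; apply.
  by apply/asboolP; rewrite -bc; exists (O (prefix_of b (nm b))); exact: nmP.
have nm_eq b c : prefix_of b (nm b) = prefix_of c (nm b) -> nm c = nm b.
  move=> bc; apply/eqP; rewrite eqn_leq nm_le //= nm_le //.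
  by apply/esym; apply: (eq_prefix_of_le _ bc); exact: nm_le.
pose N (k : set X * set X -> set X) : set Y :=
  [set p | k (O (prefix_of (branch p) (nm (branch p)))) (branch_pt p)].
have oN k : (forall b, open (k (O (prefix_of b (nm b))))) -> open (N k).
  move=> ok; rewrite branch_openE => p Np.
  exists (nm (branch p)), (k (O (prefix_of (branch p) (nm (branch p))))).
  split=> // q qp Vq; rewrite /N /=.
  by rewrite (nm_eq (branch p)) ?qp.
exists (N fst), (N snd); split.
- by apply: oN => b; have [] := nmP b.
- by apply: oN => b; have [] := nmP b.
- move=> p Ep; have [_ _ _ + _] := nmP (branch p); apply=> //.
  by rewrite /cylinder /= size_prefix_of.
- move=> p Ep; have [_ _ _ _] := nmP (branch p); apply=> //.
  by rewrite /cylinder /= size_prefix_of.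
- apply/seteqP; split=> // p [p1 p2]; have [_ _ O12 _ _] := nmP (branch p).
  by have /seteqP[/(_ (branch_pt p) (conj p1 p2))] := O12.
Qed.

End branch_topology.

(** * Bases of least cardinality and the compact space of small weight *)

Lemma minimal_basis (X : topologicalType) :
  exists B : set (set X), basis B /\ forall B' : set (set X), basis B' -> B #<= B'.
Proof.
have bo : basis (@open X).
  split=> // x A; rewrite /= nbhsE => -[V [oV Vx] VA]; by exists V.
have [[B bB] minB] := card_le_minimum
  (fun b : {B : set (set X) | basis B} => sval b) (exist _ _ bo).
by exists B; split=> // B' bB'; exact: (minB (exist _ B' bB')).
Qed.

(** Against each basic set take a member of the filter that misses it, if there is one. Finitely
    many such members have a common point, and it is a cluster point. *)
Lemma finite_basis_compact (X : topologicalType) (B : set (set X)) :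
  basis B -> finite_set B -> compact [set: X].
Proof.
move=> [oB bB] fB F PF _; apply: contrapT => nc.
have /choice[A AP] : forall V : set X, exists A, F A /\
    ((exists2 A', F A' & A' `&` V = set0) -> A `&` V = set0).
  move=> V; have [[A FA AV]|h] := pselect (exists2 A', F A' & A' `&` V = set0).
    by exists A.
  by exists setT; split; [exact: filterT|move=> /h].
have /filter_ex[x xA] : F (\bigcap_(V in [set` fset_set B]) A V).
  by apply: filter_bigI => V _; have [] := AP V.
apply: nc; exists x; split=> // A' N FA' /bB[V [BV Vx] VN].
apply: contrapT => /set0P/negP; rewrite negbK => /eqP A'N.
have [_ AV] := AP V.
have AVx : A V x by apply: xA; rewrite /= in_fset_set //; exact: mem_set.
have : (A V `&` V) x by [].
rewrite AV //; exists A' => //; apply/seteqP; split=> // y [A'y /VN Ny].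
by rewrite -A'N.
Qed.

(** If the weight is finite, [X] itself is compact. Otherwise the indices of the sieve, of the basis
    of the branch space, of the separating functions and of the basis of [Z] all inject into one
    minimal basis of [X]. *)
Lemma interpretable_open_image (X : topologicalType) : interpretable X ->
  exists (Z : topologicalType) (Y : set Z) (f : Y -> X),
    compact_hausdorff Z /\ Gdelta Y /\ continuous f /\ open_map f /\
    (forall x, exists y, f y = x) /\ weight_le Z X.
Proof.
move=> iX; have [rX [hX _]] := iX.
have [B0 [bB0 minB0]] := minimal_basis X.
have [finB0|infB0] := pselect (finite_set B0).
  exists X, setT, set_val; split; first by split=> //; exact: finite_basis_compact finB0.
  split; first by exists (fun=> setT); split=> [_|];
    [exact: openT|rewrite bigcap_const//; exists 0%N].
  split; first exact: set_val_continuous.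
  split.
    move=> _ [ O oO <-].
    suff -> : (set_val : [set: X] -> X) @` (set_val @^-1` O) = O by [].
    apply/seteqP; split=> [_ [y Oy <-] //|x Ox].
    by exists (SigSub (mem_set (I : [set: X] x))).
  split; first by move=> x; exists (SigSub (mem_set (I : [set: X] x))).
  by move=> B bB; exists B.
pose I : choiceType := B0.
have rB : range (set_val : I -> set X) = B0.
  apply/seteqP; split=> [_ [i _ <-]|V BV]; first exact: set_valP.
  by exists (SigSub (mem_set BV)).
have bI : basis (range (set_val : I -> set X)) by rewrite rB.
have infI : infinite_set [set: I].
  by rewrite (eq_finite_set (card_setT B0)).
have [U sU] := interpretable_sieve iX bI.
pose T : topologicalType := branch_space U.
have hT : hausdorff_space T by exact: branch_hausdorff.
have crT : completely_regular_space T.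
  apply: (@normal_completely_regular Rs); first exact: branch_normal.
  exact: hausdorff_accessible.
have [e esep] := @separating_family Rs _ _ _ (branch_basis U bI) crT.
have [|F PF Fn|Z [Y [G [k [[cZ GY bG] [ck ok sk]]]]]] := @embedding_compact Rs T _ e
    (fun n => [set cylinder s | s in [set s | size s = n]]) hT esep.
- move=> n p; exists (cylinder (prefix_of (branch p) n)); split.
  + by exists (prefix_of (branch p) n) => //=; exact: size_prefix_of.
  + exact: open_cylinder.
  + by rewrite /cylinder /= size_prefix_of.
- exact: branch_complete.
exists Z, Y, (@branch_pt _ _ _ \o k); do 2!split => //; split; last split; last split.
- by move=> y; apply: continuous_comp; [exact: ck|exact: branch_pt_continuous].
- by move=> A oA; rewrite -image_comp; apply: branch_pt_open => //; exact: ok.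
- move=> x; have [p <-] := branch_pt_surj sU x; have [y <-] := sk p.
  by exists y.
move=> BX bBX; exists (range G); split=> //.
apply: card_le_trans (minB0 _ bBX); apply: card_le_trans (card_image_le _ _) _.
have [phi phiI] := seq_injection infI.
have [i0 _] := infinite_setN0 infI.
have [nu [_ nuI]] := card_le_injP i0 ((infiniteP _).1 infI).
have {}nuI : injective nu by move=> i j /nuI; exact.
pose pair (p : I * I) := phi [:: p.1; p.2].
have pairI : injective pair by move=> [a b] [c d] /phiI [-> ->].
pose enc0 (j : seq I * I) := pair (phi j.1, j.2).
have enc0I : injective enc0 by move=> [a b] [c d] /pairI [/phiI -> ->].
(* A half-space is given by two basic sets of the branch space, a direction and a rational bound. *)
pose enc (j : (seq I * I) * (seq I * I) * bool * rat) :=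
  phi [:: enc0 j.1.1.1; enc0 j.1.1.2; nu (choice.pickle j.1.2); nu (choice.pickle j.2)].
have encI : injective enc.
  move=> [[[a b] c] d] [[[a' b'] c'] d'] /phiI[/= /enc0I -> /enc0I ->].
  by move=> /nuI/(pcan_inj choice.pickleK) -> /nuI/(pcan_inj choice.pickleK) ->.
apply: (@card_le_inj_image _ _ _ _ _ (fun s => set_val (phi (map enc s))) id).
  by move=> s t _ _ /val_inj/phiI/(inj_map encI).
by move=> _ [s _ <-]; rewrite image_id; exact: set_valP.
Qed.

(** * The second countable case *)

Lemma second_countable_basis (X : topologicalType) : @second_countable X ->
  exists B : nat -> set X, basis (range B).
Proof.
move=> [C /countable_injP[f fI] [oC bC]].
(* Indices that number no basic set carry the empty set. *)
have /choice[B BP] : forall n, exists V : set X,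
    (C V /\ f V = n) \/ (V = set0 /\ forall W, C W -> f W <> n).
  move=> n; have [[V CV]|h] := pselect (exists V, C V /\ f V = n).
    by exists V; left.
  by exists set0; right; split=> // W CW fW; apply: h; exists W.
exists B; apply/basisP; split=> [n|x A oA Ax].
  by have [[/oC]|[-> _]] := BP n; last exact: open0.
have [V [CV Vx] VA] := bC x A (open_nbhs_nbhs (conj oA Ax)).
exists (f V); suff -> : B (f V) = V by [].
have [[CB fB]|[_ /(_ V CV)]] := BP (f V); last by case.
by apply: fI => //; exact: mem_set.
Qed.

(** Tychonoff's argument: the basic sets whose closures miss [F] cover [E], and conversely. From the
    set of index [n] in one cover, the closures of those of index at most [n] in the other are
    removed. *)
Lemma second_countable_normal (X : topologicalType) (B : nat -> set X) :
  regular_space X -> basis (range B) -> normal_space X.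
Proof.
move=> rX /basisP[oB bB]; apply/(@normal_openP Rs) => E F cE cF EF.
pose c (A : set X) n : set X := if `[< closure (B n) `&` A = set0 >] then B n else set0.
pose u A := fix u n := if n is m.+1 then u m `|` c A n else c A 0%N.
pose G A A' := \bigcup_n (c A n `\` closure (u A' n)).
have oc A n : open (c A n) by rewrite /c; case: asboolP => // _; exact: open0.
have oG A A' : open (G A A').
  apply: bigcup_open => n _; apply: openI; first exact: oc.
  by apply: closed_openC; exact: closed_closure.
have cu A m n : (m <= n)%N -> c A m `<=` u A n.
  elim: n => [|n IH]; first by rewrite leqn0 => /eqP ->.
  by rewrite leq_eqVlt => /orP[/eqP -> |/IH mn] x cx /=; [right|left; exact: mn].
have clc A n x : A x -> ~ closure (c A n) x.
  rewrite /c; case: asboolP => [BA0 Ax Bx|_ _]; last by rewrite closure0.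
  by have : (closure (B n) `&` A) x by []; rewrite BA0.
have clu A n x : A x -> ~ closure (u A n) x.
  move=> Ax; elim: n => [|n IH] /=; first exact: clc.
  by rewrite closureU => -[//|]; exact: clc.
have sub A A' : closed A' -> A `&` A' = set0 -> A `<=` G A' A.
  move=> cA' AA0 x Ax.
  have nA'x : (~` A') x by move=> A'x; have : (A `&` A') x by []; rewrite AA0.
  have [V [oV Vx VA]] := regular_space_open rX (closed_openC cA') nA'x.
  have [n [Bx BV]] := bB _ _ oV Vx.
  exists n => //; split; last exact: clu.
  rewrite /c; case: asboolP => // h; exfalso; apply: h.
  by apply/seteqP; split=> // y [/(closureS BV)/VA].
exists (G F E), (G E F); split=> //; first exact: sub.
  by apply: sub => //; rewrite setIC.
apply/seteqP; split=> // x [[m _ [Fm nE]] [n _ [En nF]]].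
have [mn|nm] := leqP m n.
  by apply: nF; apply: subset_closure; exact: cu mn _ Fm.
by apply: nE; apply: subset_closure; exact: cu (ltnW nm) _ En.
Qed.

(** * Sieves weighted by continuous functions *)

Section cozero_sieve.
Context {R : realType}.

(** Membership in a child is certified by a positive continuous weight, which a suitable metric
    makes convergent along Cauchy sequences. *)
Definition cozero_sieve (X : topologicalType) (V : seq nat -> set X)
    (v : seq nat -> X -> R) :=
  [/\ V [::] = setT, forall s, continuous (v s) /\ forall x, 0 <= v s x,
      forall s x, 0 < v s x -> V s x,
      forall s x, V s x -> exists i, 0 < v (i :: s) x &
      forall b (F : set_system X), ProperFilter F ->
        (forall n, F (V (prefix_of b n))) -> cluster F !=set0].

(** A letter now codes a pair of an old letter and an index [j]; the weight is [e j] if its cozero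
    set lies in the node. Such cozero sets cover the node. *)
Lemma complete_sieve_cozero (X : topologicalType) (U : seq nat -> set X)
    (J : countType) (e : J -> X -> R) :
  complete_sieve U -> separating e ->
  exists V v, @cozero_sieve X V v.
Proof.
move=> [U0 oU Uex _ Ucpl] [ce e01 esep].
pose dec (n : nat) : option (nat * J) := choice.unpickle n.
(* A number that codes no pair reads as the letter 0; its weight is zero. *)
pose tr (s : seq nat) := map (fun n => oapp fst 0%N (dec n)) s.
pose v s : X -> R := if s is n :: s' then if dec n is Some (i, j) then
  if `[< forall x, 0 < e j x -> U (tr s) x >] then e j else cst 0 else cst 0
  else cst 0.
have cst0 : continuous (cst 0 : X -> R) by move=> x; exact: cvg_cst.
exists (U \o tr), v; split=> //= [[|n s]|[|n s] x|s x Ux|b F PF Fb].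
- by split.
- rewrite /v; case: (dec n) => [[i j]|]; last by split.
  case: asboolP => _; last by split.
  by split=> [|x]; [exact: ce|have /andP[] := e01 j x].
- by rewrite /= ltxx.
- rewrite /v; case E : (dec n) => [[i j]|]; last by rewrite /= ltxx.
  by case: asboolP => [h /h //|_]; rewrite /= ltxx.
- have [i Uix] := Uex _ _ Ux; have [j [ex e0]] := esep _ _ (oU _) Uix.
  exists (choice.pickle (i, j)).
  rewrite /v /tr /= /dec choice.pickleK; case: asboolP => // h; exfalso; apply: h => y ey /=.
  by apply: contrapT => /e0 ey0; rewrite ey0 ltxx in ey.
- apply: (Ucpl (fun n => oapp fst 0%N (dec (b n)))) => // n.
  by suff -> : prefix_of (fun n => oapp fst 0%N (dec (b n))) n = tr (prefix_of b n);
    [exact: Fb|elim: n => //= n ->].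
Qed.

End cozero_sieve.

Lemma near_invS_lt (R : realType) (x : R) : 0 < x ->
  \forall n \near \oo, n.+1%:R^-1 < x.
Proof.
move=> x0; have /cvgr0_norm_lt/(_ x x0) := @cvg_harmonic R.
by apply: filterS => n /=; rewrite gtr0_norm ?invr_gt0 ?ltr0n.
Qed.

(** * A truncated supremum norm for the product topology on sequences *)

Section sup_norm.
Context {R : realType}.
Implicit Types a b : nat -> R.

Definition trunc_norm a : R := sup (range (fun k => Num.min k.+1%:R^-1 `|a k|)).

Let has_sup_trunc a : has_sup (range (fun k => Num.min k.+1%:R^-1 `|a k|)).
Proof.
split; first by exists (Num.min 1%:R^-1 `|a 0%N|), 0%N.
exists 1 => _ [k _ <-]; rewrite ge_min; apply/orP; left.
by rewrite invf_le1 ?ltr0n // ler1n.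
Qed.

Lemma trunc_norm_ge a k : Num.min k.+1%:R^-1 `|a k| <= trunc_norm a.
Proof. by apply: ub_le_sup; [case: (has_sup_trunc a)|exists k]. Qed.

Lemma trunc_norm_le a (M : R) :
  (forall k, Num.min k.+1%:R^-1 `|a k| <= M) -> trunc_norm a <= M.
Proof.
by move=> aM; apply: ge_sup; [case: (has_sup_trunc a)|move=> _ [k _ <-]].
Qed.

Lemma trunc_norm_ge0 a : 0 <= trunc_norm a.
Proof.
by apply: le_trans (trunc_norm_ge a 0); rewrite le_min normr_ge0 invr_ge0 ler0n.
Qed.

Lemma trunc_norm_coord a k (x : R) : x <= k.+1%:R^-1 -> trunc_norm a < x -> `|a k| < x.
Proof.
move=> xk ax; have := le_lt_trans (trunc_norm_ge a k) ax.
by rewrite gt_min => /orP[/lt_le_trans/(_ xk)|//]; rewrite ltxx.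
Qed.

Lemma trunc_norm_eq0 a : trunc_norm a = 0 <-> forall k, a k = 0.
Proof.
split=> [a0 k|a0].
  have := trunc_norm_ge a k; rewrite a0 ge_min leNgt invr_gt0 ltr0n /=.
  by rewrite normr_le0 => /eqP.
apply/eqP; rewrite eq_le trunc_norm_ge0 andbT; apply: trunc_norm_le => k.
by rewrite a0 normr0 ge_min lexx orbT.
Qed.

Lemma trunc_norm_gt0 a k : a k != 0 -> 0 < trunc_norm a.
Proof.
move=> ak; rewrite lt_neqAle trunc_norm_ge0 andbT; apply: contra ak => /eqP/esym.
by move=> /trunc_norm_eq0 ->.
Qed.

Lemma trunc_normN a : trunc_norm (fun k => - a k) = trunc_norm a.
Proof. by rewrite /trunc_norm; under eq_fun do rewrite normrN. Qed.

Lemma trunc_normD a b :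
  trunc_norm (fun k => a k + b k) <= trunc_norm a + trunc_norm b.
Proof.
apply: trunc_norm_le => k.
apply: le_trans (lerD (trunc_norm_ge a k) (trunc_norm_ge b k)).
have ab := ler_normD (a k) (b k).
have k0 : 0 <= k.+1%:R^-1 :> R by rewrite invr_ge0 ler0n.
have a0 := normr_ge0 (a k); have b0 := normr_ge0 (b k).
move: (k.+1%:R^-1) (`|a k|) (`|b k|) (`|a k + b k|) k0 a0 b0 ab => c p q r c0 p0 q0 rpq.
rewrite ge_min; case: (leP c p) => cp; case: (leP c q) => cq; apply/orP.
- by left; lra.
- by left; lra.
- by left; lra.
- by right.
Qed.

(** The truncation bounds tend to zero, so only finitely many coordinates have to be estimated. *)
Lemma trunc_norm_cvg0 (T : Type) (F : set_system T) (h : nat -> T -> R) :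
  Filter F -> (forall k, h k @ F --> (0 : R)) ->
  trunc_norm \o (fun y k => h k y) @ F --> (0 : R).
Proof.
move=> FF h0; apply/cvgr0Pnorm_le => /= e e0.
have [N _ Ne] := near_invS_lt e0.
have Fs M : F [set y | forall k, (k < M)%N -> `|h k y| <= e].
  elim: M => [|M IH]; first by apply: filterS filterT => y _ k.
  have /cvgr0_norm_le/(_ e e0) FM := h0 M.
  apply: filterS2 IH FM => y yM yM' k; rewrite ltnS leq_eqVlt.
  by move=> /orP[/eqP -> //|/yM].
apply: filterS (Fs N) => y yN /=; rewrite ger0_norm ?trunc_norm_ge0 //.
apply: trunc_norm_le => k; have [/yN kN|Nk] := ltnP k N.
  by rewrite ge_min kN orbT.
by rewrite ge_min; apply/orP; left; exact/ltW/Ne.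
Qed.

(** The reverse triangle inequality reduces this to differences that tend to zero. *)
Lemma trunc_norm_continuous (X : topologicalType) (h : nat -> X -> R) :
  (forall k, continuous (h k)) -> continuous (fun x => trunc_norm (h^~ x)).
Proof.
move=> ch x; apply/subr_cvg0.
have h0 : trunc_norm \o (fun y k => h k y - h k x) @ x --> (0 : R).
  by apply: trunc_norm_cvg0 => k; apply/subr_cvg0; exact: ch.
apply: norm_cvg0; move/cvgr0Pnorm_le : h0 => h0; apply/cvgr0Pnorm_le => e /h0.
apply: filterS => y /=; rewrite normr_id; apply: le_trans.
rewrite [leRHS]ger0_norm ?trunc_norm_ge0 //.
have h1 : trunc_norm (h^~ y) <= trunc_norm (fun k => h k y - h k x) + trunc_norm (h^~ x).
  apply: le_trans (trunc_normD _ _).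
  by under [in leRHS]eq_fun do rewrite subrK.
have h2 : trunc_norm (h^~ x) <= trunc_norm (fun k => h k y - h k x) + trunc_norm (h^~ y).
  rewrite -[trunc_norm (fun k => _ - _)]trunc_normN; apply: le_trans (trunc_normD _ _).
  by under [in leRHS]eq_fun do rewrite opprB subrK.
by rewrite ler_norml; apply/andP; split; lra.
Qed.

End sup_norm.

(** * Damped weights on the tree and Koenig's lemma *)

Section tree_weight.
Context {R : realType}.
Implicit Types c : seq nat -> R.

(* The damping product makes the children of each node finite in number
   wherever the weights are positive, even for weights that are only limits. *)
Fixpoint tree_weight c (s : seq nat) : R :=
  if s is i :: s' then tree_weight c s' * c s *
    \prod_(j < i) Num.max 0 (i.+1%:R^-1 - tree_weight c s' * c (nat_of_ord j :: s'))
  else 1.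

Lemma tree_weight_ge0 c s : (forall s, 0 <= c s) -> 0 <= tree_weight c s.
Proof.
move=> c0; elim: s => [|i s IH] /=; first exact: ler01.
apply: mulr_ge0; first exact: mulr_ge0.
by apply: prodr_ge0 => j _; rewrite le_max lexx.
Qed.

Lemma tree_weight_parent c i s : (forall s, 0 <= c s) ->
  0 < tree_weight c (i :: s) -> 0 < tree_weight c s /\ 0 < c (i :: s).
Proof.
move=> c0 ts; have tn0 := lt0r_neq0 ts; move: tn0 => /=.
rewrite !mulf_eq0 !negb_or => /andP[/andP[t0 ci] _].
by rewrite !lt_neqAle ![0 == _]eq_sym t0 ci c0 tree_weight_ge0.
Qed.

(** For the least [i] with positive [c (i :: s)], every damping factor equals the inverse of
    [i.+1]. *)
Lemma tree_weight_child c s : (forall s, 0 <= c s) -> 0 < tree_weight c s ->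
  (exists i, 0 < c (i :: s)) -> exists i, 0 < tree_weight c (i :: s).
Proof.
move=> c0 ts ex; case: (ex_minnP ex) => i ci imin; exists i => /=.
apply: mulr_gt0; first exact: mulr_gt0.
apply: prodr_gt0 => j _; have -> : c (nat_of_ord j :: s) = 0.
  apply/eqP; rewrite eq_le c0 andbT leNgt; apply/negP => /imin.
  by rewrite leqNgt ltn_ord.
by rewrite mulr0 subr0 lt_max invr_gt0 ltr0n orbT.
Qed.

(** Once a child [j] has positive weight, the damping factor it contributes vanishes for all large
    [i]. *)
Lemma tree_weight_finite c s : (forall s, 0 <= c s) ->
  exists N, forall i, 0 < tree_weight c (i :: s) -> (i < N)%N.
Proof.
move=> c0; have [[j tj]|h] := pselect (exists j, 0 < tree_weight c (j :: s)); last first.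
  by exists 0%N => i ti; exfalso; apply: h; exists i.
have [ts cj] := tree_weight_parent c0 tj.
pose x := tree_weight c s * c (j :: s).
have x0 : 0 < x by exact: mulr_gt0.
have [N _ Nx] := near_invS_lt x0.
exists (maxn j.+1 N) => i ti; rewrite ltnNge geq_max; apply/negP => /andP[ji Ni].
have : tree_weight c (i :: s) = 0.
  rewrite /= (bigD1 (Ordinal ji)) //= -/x; have -> : Num.max 0 (i.+1%:R^-1 - x) = 0.
    by apply/max_idPl; rewrite subr_le0; exact/ltW/Nx.
  by rewrite mul0r mulr0.
by move=> t0; rewrite t0 ltxx in ti.
Qed.

(** The value at [s] is a finite expression in the weights, hence passes to limits; [c] need not be
    the weights of any point. *)
Lemma tree_weight_cvg (T : Type) (F : set_system T) (v : seq nat -> T -> R) c s :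
  Filter F -> (forall s, v s @ F --> c s) ->
  (fun y => tree_weight (v^~ y) s) @ F --> tree_weight c s.
Proof.
move=> FF vc; elim: s => [|i s IH]; first exact: cvg_cst.
have cmax : continuous (Num.max (0 : R)).
  move=> r; apply: (@continuous_max _ _ (cst 0) id); first exact: cvg_cst.
  exact: cvg_id.
apply: cvgM; first exact: cvgM.
apply: cvg_big; first exact: mul_continuous.
move=> j _; apply: (continuous_cvg _ (cmax _)); apply: cvgB; first exact: cvg_cst.
exact: cvgM.
Qed.

Lemma koenig (P : set (seq nat)) :
  (forall i s, P (i :: s) -> P s) ->
  (forall s, exists N, forall i, P (i :: s) -> (i < N)%N) ->
  (forall n, exists2 s, size s = n & P s) ->
  exists b, forall n, P (prefix_of b n).
Proof.
move=> Pdown Pfin Pn.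
have Pcat t s : P (t ++ s) -> P s by elim: t => //= i t IH /Pdown.
pose Q s := forall n, exists2 t, size t = n & P (t ++ s).
have Q0 : Q [::] by move=> n; have [s sn Ps] := Pn n; exists s; rewrite ?cats0.
have Qex s : Q s -> exists i, Q (i :: s).
  move=> Qs; apply: contrapT => /forallNP nQ.
  have /choice[m mP] : forall i, exists m, forall t, size t = m -> ~ P (t ++ i :: s).
    move=> i; have /existsNP[m mP] := nQ i.
    by exists m => t tm Pt; apply: mP; exists t.
  (* Only finitely many children lie in [P], so a descendant of [s] beyond all their bounds passes
     through a child without descendants that far. *)
  have [N NP] := Pfin s.
  have [t tN Pt] := Qs (\max_(i < N) m i).+1.
  case/lastP: t tN Pt => [//|t i]; rewrite size_rcons cat_rcons => -[tN] Pt.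
  have iN : (i < N)%N by apply: NP; exact: Pcat Pt.
  have mi : (m i <= size t)%N by rewrite tN (leq_bigmax (Ordinal iN)).
  apply: (mP i (drop (size t - m i) t)); first by rewrite size_drop subKn.
  by apply: (Pcat (take (size t - m i) t)); rewrite catA cat_take_drop.
have /choice[nxt nxtP] : forall s : {s | Q s}, exists i, Q (i :: sval s).
  by move=> [s Qs]; exact: Qex.
pose st n := iter n (fun s => exist Q (nxt s :: sval s) (nxtP s)) (exist Q [::] Q0).
exists (fun n => nxt (st n)) => n.
have -> : prefix_of (fun n => nxt (st n)) n = sval (st n).
  by elim: n => //= n ->.
by have [t /size0nil -> /=] := proj2_sig (st n) 0%N.
Qed.

End tree_weight.

(** * The complete metric *)

Lemma min_invS_gt0 (R : realType) k (x : R) : 0 < x ->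
  0 < Num.min k.+1%:R^-1 x.
Proof. by move=> x0; rewrite lt_min x0 invr_gt0 ltr0n. Qed.

(** The metric compares the separating functions, the weights of the sieve and the reciprocals of
    [w n], where [w n] measures the damped weights at depth [n]. Along a Cauchy sequence all of
    these converge. The reciprocals keep some limit weight positive at each depth, and Koenig's
    lemma gives a branch each of whose nodes contains the sequence eventually. *)
Lemma cozero_sieve_metric (R : realType) (X : topologicalType) (J : countType)
    (e : J -> X -> R) (V : seq nat -> set X) (v : seq nat -> X -> R) :
  hausdorff_space X -> separating e -> cozero_sieve V v ->
  exists d : X -> X -> R,
    (forall x y, 0 <= d x y) /\
    (forall x y, d x y = 0 <-> x = y) /\
    (forall x y, d x y = d y x) /\
    (forall x y z, d x z <= d x y + d y z) /\
    (forall U : set X, open U <->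
       (forall x, U x -> exists2 r : R, 0 < r & [set y | d x y < r] `<=` U)) /\
    (forall u : nat -> X,
       (forall r : R, 0 < r -> exists N : nat, forall m n : nat,
           (N <= m)%N -> (N <= n)%N -> d (u m) (u n) < r) ->
       exists l : X, u @ \oo --> l).
Proof.
move=> hX [ce e01 esep] [V0 cv0 vV Vv Vcpl].
have cv s : continuous (v s) by case: (cv0 s).
have v0 x s : 0 <= v s x by case: (cv0 s).
pose t s x := tree_weight (v^~ x) s.
have tV s x : 0 < t s x -> V s x.
  case: s => [|i s]; first by rewrite V0.
  by move=> /(tree_weight_parent (v0 x))[_ /vV].
have tlev n x : exists2 s, size s = n & 0 < t s x.
  elim: n => [|n [s <- ts]]; first by exists [::] => //; exact: ltr01.
  have [i ti] := tree_weight_child (v0 x) ts (Vv _ _ (tV _ _ ts)).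
  by exists (i :: s).
have ct s : continuous (t s).
  by move=> x; apply: tree_weight_cvg => s'; exact: cv.
pose lev n k x := if choice.unpickle k is Some s then
  if size (s : seq nat) == n then t s x else 0 else 0.
have clev n k : continuous (lev n k).
  rewrite /lev; case: (choice.unpickle k) => [s|]; last by move=> x; exact: cvg_cst.
  by case: eqP => _; [exact: ct|move=> x; exact: cvg_cst].
pose w n x := trunc_norm (fun k => lev n k x).
have w0 n x : 0 < w n x.
  have [s sn ts] := tlev n x; apply: (@trunc_norm_gt0 _ _ (choice.pickle s)).
  by rewrite /lev choice.pickleK sn eqxx gt_eqF.
have cw n : continuous (w n) by exact: trunc_norm_continuous.
pose g (c : J + seq nat + nat) : X -> R := match c with
  | inl (inl j) => e j | inl (inr s) => v s | inr n => fun x => (w n x)^-1 end.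
have cg c : continuous (g c).
  case: c => [[j|s]|n]; [exact: ce|exact: cv|].
  by move=> x; apply: cvgV; [rewrite gt_eqF|exact: cw].
pose G k : X -> R := if choice.unpickle k is Some c then g c else cst 0.
have cG k : continuous (G k).
  by rewrite /G; case: choice.unpickle => [c|]; [exact: cg|move=> x; exact: cvg_cst].
have GE c : G (choice.pickle c) = g c by rewrite /G choice.pickleK.
pose d x y := trunc_norm (fun k => G k x - G k y).
(* The threshold is at most the truncation bound of the coordinate, so below it the truncation has
   no effect. *)
have d_g c (r : R) : 0 < r -> exists2 r', 0 < r' &
    forall x y, d x y < r' -> `|g c x - g c y| < r.
  move=> r0; exists (Num.min (choice.pickle c).+1%:R^-1 r); first exact: min_invS_gt0.
  move=> x y dxy; rewrite -GE.
  apply: (@lt_le_trans _ _ (Num.min (choice.pickle c).+1%:R^-1 r)).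
    by apply: trunc_norm_coord dxy; rewrite ge_min lexx.
  by rewrite ge_min lexx orbT.
exists d; split; [|split; [|split; [|split; [|split]]]].
- by move=> x y; exact: trunc_norm_ge0.
- move=> x y; split=> [/trunc_norm_eq0 dxy|->]; last first.
    by apply/trunc_norm_eq0 => k; rewrite subrr.
  apply: contrapT => /eqP xy.
  have [A [oA /set_mem Ax /set_mem nAy]] := hausdorff_accessible hX xy.
  have [j [ex ey]] := esep _ _ oA Ax.
  have := dxy (choice.pickle (inl (inl j) : J + seq nat + nat)).
  by rewrite GE /= (ey y nAy) subr0 => ex0; rewrite ex0 ltxx in ex.
- move=> x y; rewrite /d -trunc_normN.
  by under eq_fun do rewrite opprB.
- move=> x y z; apply: le_trans (trunc_normD _ _).
  by under [in leRHS]eq_fun do rewrite addrA subrK.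
- move=> U; split=> [oU x Ux|Ud].
    have [j [ex e0]] := esep _ _ oU Ux.
    have [r r0 dr] := d_g (inl (inl j)) _ ex.
    exists r => // y /dr /= exy; apply: contrapT => /e0 ey.
    by move: exy; rewrite ey subr0 ger0_norm ?ltxx // ltW.
  rewrite openE => x /Ud[r r0 rU].
  suff : \forall y \near x, d x y < r by apply: filterS => y; exact: rU.
  have : trunc_norm \o (fun y k => G k x - G k y) @ x --> (0 : R).
    apply: trunc_norm_cvg0 => k; rewrite -(subrr (G k x)).
    by apply: cvgB; [exact: cvg_cst|exact: cG].
  move=> /cvgr0_norm_lt/(_ r r0); apply: filterS => y /=.
  by rewrite ger0_norm // trunc_norm_ge0.
move=> u cu.
have gcvg c : exists l : R, g c (u m) @[m --> \oo] --> l.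
  apply/cvg_ex; apply: cauchy_cvg; apply: cauchy_exP => r r0.
  have [r' r'0 dr'] := d_g c _ r0; have [N uN] := cu _ r'0.
  exists (g c (u N)), N => // m /= Nm; rewrite /ball /=.
  by apply: dr'; exact: uN.
have /choice[L gL] := gcvg.
(* Limits of the weights along [u], taken before any limit point is known. *)
pose c s := L (inl (inr s)).
have vc s : v s (u m) @[m --> \oo] --> c s by exact: (gL (inl (inr s))).
have c0 s : 0 <= c s.
  have h : \forall m \near \oo, [set r : R | 0 <= r] (v s (u m)).
    by apply: nearW => m; exact: v0.
  have := @closed_cvg _ _ _ _ _ [set r : R | 0 <= r] (@closed_ge _ 0) h _ (vc s).
  exact.
pose a s := tree_weight c s.
have ta s : t s (u m) @[m --> \oo] --> a s.
  by apply: (@tree_weight_cvg _ _ _ (fun s m => v s (u m))).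
have [b ab] : exists b, forall n, 0 < a (prefix_of b n).
  apply: (@koenig (fun s => 0 < a s)) => [i s /(tree_weight_parent c0)[]//|s|n].
    exact: tree_weight_finite.
  apply: contrapT => na.
  (* If all limit weights at depth [n] vanished, [w n] would tend to zero along [u] while its
     reciprocal converges. *)
  have wc : w n (u m) @[m --> \oo] --> (0 : R).
    apply: (@trunc_norm_cvg0 _ _ _ (fun k m => lev n k (u m))) => k.
    rewrite /lev; case: (choice.unpickle k) => [s|]; last exact: cvg_cst.
    case: eqP => [sn|_]; last exact: cvg_cst.
    have -> : 0 = a s; last exact: ta.
    apply/eqP; rewrite eq_le tree_weight_ge0 //= leNgt; apply/negP => as0.
    by apply: na; exists s.
  have := cvgM (gL (inr n)) wc; rewrite mulr0 /=.
  rewrite (_ : _ \* _ = cst 1); last by apply/funext => m /=; rewrite mulVf // gt_eqF.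
  move=> h; have {}h : cst (1 : R) x @[x --> \oo] --> (0 : R) by exact: h.
  have h1 : cst (1 : R) x @[x --> \oo] --> (1 : R) by exact: cvg_cst.
  have := cvg_lim (@Rhausdorff R) h; rewrite (cvg_lim (@Rhausdorff R) h1) => /(_ _)/eqP.
  by rewrite oner_eq0.
have [n|x xu] := Vcpl b (u @ \oo) _.
  have /cvgr_gt/(_ _ (ab n)) := ta (prefix_of b n).
  by apply: filterS => m; exact: tV.
exists x => A; rewrite nbhsE => -[A' [oA' A'x] A'A].
have [j [ex e0]] := esep _ _ oA' A'x.
(* At the cluster point each [e j] takes its limit along [u]; a positive limit keeps the tail of [u]
   in the given neighbourhood. *)
have eL : e j x = L (inl (inl j)).
  apply/esym/(@Rhausdorff R) => N M LN /ce xM.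
  have [||y [Ny My]] := xu (e j @^-1` N) (e j @^-1` M) => //.
    exact: (gL (inl (inl j)) N LN).
  by exists (e j y).
have /cvgr_gt/(_ 0) := gL (inl (inl j)); rewrite -eL => /(_ ex).
apply: filterS => m /= em; apply: A'A; apply: contrapT => /e0 em0.
by rewrite em0 ltxx in em.
Qed.

Lemma interpretable_second_countable_polish (X : topologicalType) :
  interpretable X -> @second_countable X -> polish X.
Proof.
move=> iX sX; have [rX [hX _]] := iX.
have [B bB] := second_countable_basis sX; split.
  (* The dense set takes one point from each nonempty basic set; the option type serves where there
     is no point to choose. *)
  have /choice[D DP] : forall n, exists x : option X,
      B n !=set0 -> exists2 y, x = Some y & B n y.
    move=> n; have [[y By]|h] := pselect (B n !=set0); first by exists (Some y) => _; exists y.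
    by exists None.
  exists [set x | exists n, D n = Some x]; split.
    apply: (@sub_countable _ _ _ [set: nat]); last exact: countableP.
    have : some @` [set x | exists n, D n = Some x] `<=` range D.
      by move=> _ [x [n Dn] <-]; exists n.
    move=> /subset_card_le; rewrite (card_le_eql card_some) => /card_le_trans; apply.
    exact: card_image_le.
  move=> A [x Ax] oA; have [oB bB'] := (basisP B).1 bB.
  have [n [Bx BA]] := bB' _ _ oA Ax.
  by have [|y Dy By] := DP n; [exists x|exists y; split; [exact: BA|exists n]].
have nX := second_countable_normal rX bB.
have crX : completely_regular_space X.
  by apply: (@normal_completely_regular Rs) => //; exact: hausdorff_accessible.
have [e esep] := @separating_family Rs _ _ _ bB crX.
have [U sU] := interpretable_sieve iX bB.
have [V [v sv]] := complete_sieve_cozero sU esep.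
exact: cozero_sieve_metric hX esep sv.
Qed.

Theorem mainTheorem18 :
  (forall X : topologicalType, interpretable X ->
     exists (Z : topologicalType) (Y : set Z) (f : (Y : Type) -> X),
       compact_hausdorff Z /\ Gdelta Y /\
       continuous f /\ open_map f /\ (forall x : X, exists y, f y = x) /\
       weight_le Z X) /\
  (forall X : topologicalType, interpretable X -> @second_countable X ->
     polish X).
Proof.
split; first exact: interpretable_open_image.
exact: interpretable_second_countable_polish.
Qed.
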